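(* For every prime $p$ with $p \neq 2$ and $p \neq 5$, there exists a unique $t(p) \in \mathbb{Z}_p = \{0, 1, \dots, p-1\}$ such that for all $n \in \mathbb{N}$, $$p \mid n \iff p \,\Big|\, \Big\lfloor \frac{n}{10} \Big\rfloor - t(p)\, ud(n).$$ Moreover, $$t(p) = \begin{cases} \frac{p-1}{10} & \text{if } ud(p) = 1,\\ \frac{7p-1}{10} & \text{if } ud(p) = 3,\\ \frac{3p-1}{10} & \text{if } ud(p) = 7,\\ \frac{9p-1}{10} & \text{if } ud(p) = 9.\end{cases}$$
   Context: For $n \in \mathbb{N}$ (the natural numbers), $ud(n)$ denotes the unit digit of $n$ in base $10$, i.e. $ud(n) = n - 10\lfloor n/10 \rfloor \in \{0, 1, \dots, 9\}$. Here $\mathbb{Z}_p$ denotes the residues modulo $p$, represented by the integers $0, 1, \dots, p-1$, and $t(p)$ is regarded as such an integer. The divisibility $p \mid \lfloor n/10 \rfloor - t(p)\,ud(n)$ is divisibility of integers (the right-hand side may be negative or zero). *)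

(* Defs.v *)
From HB Require Import structures.
From mathcomp Require Import all_boot all_order all_algebra.
Set Implicit Arguments.
Unset Strict Implicit.
Unset Printing Implicit Defensive.

(* The truncated subtraction is exact here, since 10 * (n %/ 10) <= n. *)
Definition ud (n : nat) : nat := n - 10 * (n %/ 10).

(* The difference is taken in int because it may be negative. *)
Definition unit_digit_test (p : nat) (t : 'I_p) : Prop :=
  forall n : nat,
    (p %| n)%N <-> (p%:Z %| ((n %/ 10)%N%:Z - t%:Z * (ud n)%:Z)%R)%Z.

(* Main.v *)
Require Import Defs.
From HB Require Import structures.
From mathcomp Require Import all_boot all_order all_algebra.
From mathcomp Require Import zify ring.
Import GRing.Theory.
Local Open Scope ring_scope.

(** The multiplier [t] is minus the inverse of [10] modulo [p].  Suppose
    [p] divides [10 t + 1], and write [n = 10 q + u] with [u] the unit digit.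
    Then [n - 10 (q - t u) = (10 t + 1) u] is a multiple of [p], and [10] is
    invertible modulo [p], so [p] divides [n] exactly when it divides
    [q - t u] ([unit_digit_test_multiplier]).

    Conversely, the single number [n = 10 t + 1], a multiple of [p] with unit
    digit [1] and quotient [t], forces every other valid multiplier to be
    congruent to [t] modulo [p], hence equal to it
    ([unique_unit_digit_test]).

    It remains to find [t].  Since [p] is coprime to [10], its unit digit [d]
    is a unit modulo [10] ([ud_prime]); if [c] in [{1, 3, 7, 9}] is the inverse
    of [d] modulo [10], then [c p] has unit digit [1], and [t = (c p - 1) / 10]
    is smaller than [p] because [c < 10].  This gives the four formulas. *)

Lemma ud_modn n : ud n = (n %% 10)%N.
Proof. by rewrite /ud; lia. Qed.

Lemma ud_prime p : prime p -> p <> 2%N -> p <> 5%N ->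
  ud p \in [:: 1; 3; 7; 9]%N.
Proof.
move=> p_prime p_neq2 p_neq5.
have n2p : ~~ (2 %| p)%N by rewrite dvdn_prime2 //; apply/eqP; lia.
have n5p : ~~ (5 %| p)%N by rewrite dvdn_prime2 //; apply/eqP; lia.
by rewrite ud_modn !inE; lia.
Qed.

(** The hypothesis itself makes [10] invertible modulo [p], which lets the
    factor [10] be cancelled from [n = 10 (q - t u) + (10 t + 1) u] modulo [p]. *)
Lemma unit_digit_test_multiplier p (t : 'I_p) :
  (p %| 10 * t + 1)%N -> unit_digit_test t.
Proof.
move=> p_dvd n.
have p_coprime10 : coprimez p%:Z 10.
  (* A common divisor of [p] and [10] divides both [10 t + 1] and [10 t]. *)
  rewrite /coprimez /gcdz /=.
  apply: (coprime_dvdl p_dvd).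
  by rewrite /coprime mulnC gcdnC gcdnMDl.
have nE : n%:Z = 10 * ((n %/ 10)%N%:Z - t%:Z * (ud n)%:Z)
                 + (10 * t + 1)%N%:Z * (ud n)%:Z.
  have -> : n%:Z = 10 * (n %/ 10)%N%:Z + (ud n)%:Z by rewrite ud_modn; lia.
  by rewrite PoszD PoszM; ring.
have -> : (p %| n)%N = (p%:Z %| n%:Z)%Z by [].
rewrite {1}nE rpredDr; last exact: dvdz_mulr.
by rewrite Gauss_dvdzr.
Qed.

(** Uniqueness comes from the test at the one number [10 t + 1], which reads
    [p | t - t'] for any other multiplier [t']. *)
Lemma unique_unit_digit_test p (t : 'I_p) :
  (p %| 10 * t + 1)%N -> unique (@unit_digit_test p) t.
Proof.
move=> p_dvd; split=> [|t' test_t']; first exact: unit_digit_test_multiplier.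
have /(test_t' _) := p_dvd.
have -> : ((10 * t + 1) %/ 10)%N = t :> nat by lia.
have -> : ud (10 * t + 1) = 1%N by rewrite ud_modn; lia.
rewrite mulr1 -eqz_mod_dvd !modz_nat eqz_nat !modn_small // => /eqP.
exact: val_inj.
Qed.

(** The inverse modulo [10] of a digit coprime to [10]. *)
Definition inv_digit (d : nat) : nat :=
  if d == 3%N then 7 else if d == 7%N then 3 else d.

Lemma inv_digitP p : ud p \in [:: 1; 3; 7; 9]%N ->
  (inv_digit (ud p) * p)%N = (10 * ((inv_digit (ud p) * p) %/ 10) + 1)%N.
Proof.
rewrite ud_modn !inE /inv_digit.
by case/or4P=> /eqP dE; rewrite dE /=; lia.
Qed.

Lemma natr_multiplier (c p t : nat) : (c * p = 10 * t + 1)%N ->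
  t%:R = (c%:R * p%:R - 1) / 10%:R :> rat.
Proof.
by move=> cpE; rewrite -natrM cpE natrD natrM addrK mulrC mulKf.
Qed.

Theorem theorem1 (p : nat) (p_prime : prime p) (p_neq2 : p <> 2%N)
    (p_neq5 : p <> 5%N) :
  exists t : 'I_p,
    unique (@unit_digit_test p) t /\
    (ud p \in [:: 1%N; 3%N; 7%N; 9%N]) /\
    [/\ ud p = 1%N -> (t : nat)%:R = (p%:R - 1) / 10%:R :> rat,
        ud p = 3%N -> (t : nat)%:R = (7%:R * p%:R - 1) / 10%:R :> rat,
        ud p = 7%N -> (t : nat)%:R = (3%:R * p%:R - 1) / 10%:R :> rat &
        ud p = 9%N -> (t : nat)%:R = (9%:R * p%:R - 1) / 10%:R :> rat].
Proof.
have ud_p := ud_prime _ p_prime p_neq2 p_neq5.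
have cpE := inv_digitP _ ud_p.
have t_lt : ((inv_digit (ud p) * p) %/ 10 < p)%N.
  rewrite ltn_divLR // mulnC ltn_pmul2l ?prime_gt0 //.
  by move: ud_p; rewrite !inE => /or4P[] /eqP ->.
exists (Ordinal t_lt); split; last split=> //.
  by apply: unique_unit_digit_test; rewrite /= -cpE dvdn_mull.
have tE := natr_multiplier _ _ _ cpE.
by split=> dE; rewrite /= tE dE /inv_digit /= ?mul1r.
Qed.
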